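(* Let $G=K_{m_1,\ldots,m_k}$ be a complete multipartite graph with $k\ge 2$, $1\le m_1\le m_2\le\cdots\le m_k$ and $m_k\ge 2$. Let $\sigma:=|\{i\mid m_i=1\}|$ and $\lambda:=|\{i\mid m_i\ge 2\}|$. If $\lambda=1$, then $\operatorname{nim}(\mathrm{DNT}(G))=\operatorname{pty}(\sigma)$ and $\operatorname{nim}(\mathrm{TER}(G))=1+\operatorname{pty}(\sigma)$.
   Context: For a graph $G$ with vertex set $V$, a set $K\subseteq V$ is convex if it contains every vertex lying on any shortest path between two elements of $K$. The convex hull $[P]$ of $P\subseteq V$ is the smallest convex set containing $P$. For an integer $k$, $\operatorname{pty}(k):=k\bmod 2\in\{0,1\}$. The game $\mathrm{DNT}(G)$: positions are the sets $P\subseteq V$ with $[V\setminus P]=V$; the starting position is $\emptyset$; the options of $P$ are the sets $P\cup\{v\}$ with $v\in V\setminus P$ and $[V\setminus(P\cup\{v\})]=V$. The game $\mathrm{TER}(G)$: positions are the sets $P\subseteq V$ reachable from the starting position $\emptyset$ by the following moves. If $[V\setminus P]=V$, then the options of $P$ are all sets $P\cup\{v\}$ with $v\in V\setminus P$; if $[V\setminus P]\neq V$, then $P$ is terminal (has no options). The nim-value of a position is defined recursively by $\operatorname{nim}(p)=\operatorname{mex}\{\operatorname{nim}(q): q\text{ an option of }p\}$, where $\operatorname{mex}(A)$ is the smallest nonnegative integer not in $A$; the nim-value of a game is that of its starting position. *)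

(* Defs.v *)
From HB Require Import structures.
From mathcomp Require Import all_boot.
From mathcomp Require Import boolp.

Set Implicit Arguments.
Unset Strict Implicit.
Unset Printing Implicit Defensive.

Definition pty (n : nat) : nat := n %% 2.

Record sgraph := SGraph {
  vertex :> finType;
  adj : rel vertex;
  adj_sym : symmetric adj;
  adj_irrefl : irreflexive adj }.

Section Convexity.
Variable G : sgraph.
Implicit Types (x y : G) (p q : seq G) (K P : {set G}).

(* As in [path], the path from x with successive vertices p is x :: p; its
   length is size p.  A walk of minimal length never repeats a vertex. *)
Definition shortest_path x y p : Prop :=
  [/\ path (@adj G) x p, last x p = y &
      forall q, path (@adj G) x q -> last x q = y -> size p <= size q].

Definition convex K : Prop :=
  forall x y p, x \in K -> y \in K -> shortest_path x y p ->
  {subset x :: p <= K}.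

Definition hull P : {set G} := \bigcap_(K | `[< convex K >] && (P \subset K)) K.

Lemma sub_hull P : P \subset hull P.
Proof. by apply/bigcapsP => K /andP[]. Qed.

Lemma hull_convex P : convex (hull P).
Proof.
move=> x y p /bigcapP xP /bigcapP yP sp z zp; apply/bigcapP => K cK.
have /andP[/asboolP convK _] := cK.
exact: convK (xP _ cK) (yP _ cK) sp _ zp.
Qed.

Lemma hull_min P K : convex K -> P \subset K -> hull P \subset K.
Proof. by move=> /asboolP cK PK; apply: bigcap_inf; rewrite cK. Qed.

End Convexity.

Record game := Game {
  position : finType;
  opt : rel position;  (* opt p q: q is an option of p *)
  start : position;
  opt_wf : well_founded (fun q p => opt p q) }.

Fact mex_ex (s : seq nat) : exists n, n \notin s.
Proof.
exists (\max_(i <- s) i).+1; apply/negP => ins.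
by have := @leq_bigmax_seq _ s xpredT id _ ins isT; rewrite /= ltnn.
Qed.

Definition mex (s : seq nat) : nat := ex_minn (mex_ex s).

Definition nim_pos (Ga : game) : position Ga -> nat :=
  Fix (@opt_wf Ga) (fun=> nat)
    (fun p rec => mex [seq rec (val q) (valP q) | q : {q | opt p q}]).

Definition nim (Ga : game) : nat := nim_pos (start Ga).

Lemma eq_mex (s t : seq nat) : s =i t -> mex s = mex t.
Proof.
move=> st; rewrite /mex.
by apply: eq_ex_minn => n; rewrite st.
Qed.

Lemma nim_posE (Ga : game) (p : position Ga) :
  nim_pos p = mex [seq nim_pos q | q in opt p].
Proof.
rewrite /nim_pos Fix_eq => [|x f g fg]; last first.
  by congr mex; apply: eq_map => q; apply: fg.
apply: eq_mex => n; apply/imageP/imageP => [[q _ ->]|[q pq ->]].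
  by exists (val q) => //; apply: (valP q).
by exists (Sub q pq : {q | opt p q}).
Qed.

Section Games.
Variable G : sgraph.
Implicit Types P Q : {set G}.

Definition spanning_compl P : bool := hull (~: P) == setT.

Definition adds_vertex P Q : bool := [exists v, (v \notin P) && (Q == v |: P)].

Lemma adds_vertex_card P Q : adds_vertex P Q -> #|Q| = #|P|.+1.
Proof. by case/existsP=> v /andP[vP /eqP->]; rewrite cardsU1 vP. Qed.

Lemma adds_vertex_wf (S : Type) (f : S -> {set G}) (r : rel S) :
  (forall p q, r p q -> adds_vertex (f p) (f q)) ->
  well_founded (fun q p => r p q).
Proof.
move=> rf p; have [n] := ubnP #|~: f p|.
elim: n p => [//|n IHn] p lt_p_n; constructor=> q /rf/adds_vertex_card pq.
apply: IHn; rewrite -ltnS; apply: leq_trans lt_p_n; rewrite ltnS.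
by rewrite -(ltn_add2l #|f q|) cardsC pq addSn cardsC.
Qed.

Fact dnt_start : spanning_compl set0.
Proof. by rewrite /spanning_compl setC0 -subTset sub_hull. Qed.

Definition dnt_position : finType := {P : {set G} | spanning_compl P}.

Definition dnt_opt : rel dnt_position :=
  fun p q => adds_vertex (val p) (val q).

Definition DNT : game :=
  @Game dnt_position dnt_opt (exist _ set0 dnt_start)
    (@adds_vertex_wf _ val dnt_opt (fun _ _ => id)).

Definition ter_move : rel {set G} :=
  fun P Q => spanning_compl P && adds_vertex P Q.

Definition ter_position : finType := {P : {set G} | connect ter_move set0 P}.

Definition ter_opt : rel ter_position := fun p q => ter_move (val p) (val q).

Lemma ter_opt_adds (p q : ter_position) :
  ter_opt p q -> adds_vertex (val p) (val q).
Proof. by case/andP. Qed.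

Definition TER : game :=
  @Game ter_position ter_opt (exist _ set0 (connect0 _ _))
    (@adds_vertex_wf _ val ter_opt ter_opt_adds).

End Games.

Section CompleteMultipartite.
Variables (k : nat) (m : k.-tuple nat).

(* The j-th vertex of the i-th part is [Tagged _ j], with [tag] its part i. *)
Definition cmp_vertex : finType := {i : 'I_k & 'I_(tnth m i)}.

Definition cmp_adj : rel cmp_vertex := fun x y => tag x != tag y.

Fact cmp_adj_sym : symmetric cmp_adj.
Proof. by move=> x y; rewrite /cmp_adj eq_sym. Qed.

Fact cmp_adj_irrefl : irreflexive cmp_adj.
Proof. by move=> x; rewrite /cmp_adj eqxx. Qed.

Definition complete_multipartite : sgraph :=
  SGraph cmp_adj_sym cmp_adj_irrefl.

End CompleteMultipartite.

(* Main.v *)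
Require Import Defs.
From HB Require Import structures.
From mathcomp Require Import all_boot.

Set Implicit Arguments.
Unset Strict Implicit.
Unset Printing Implicit Defensive.

(** Let A be the set of the sigma vertices lying in the singleton parts, and B
the part of size at least 2.  A vertex of B is simplicial (its neighbourhood A
is a clique), so its removal leaves a convex set; conversely, two vertices of B
are joined by geodesics through every vertex of A, so the hull of any set
containing B is everything.  Hence the complement of P spans exactly when P is
included in A: DNT amounts to filling A one vertex at a time, while in TER a
player may also end the game at once by taking a vertex of B.  An induction on
s = #|A :\: P| gives the values pty s and 1 + pty s, respectively. *)

Lemma mex_eq (s : seq nat) n :
  n \notin s -> (forall i, i < n -> i \in s) -> mex s = n.
Proof.
move=> ns lt_s; rewrite /mex; case: ex_minnP => j js jmin.
apply/eqP; rewrite eqn_leq jmin //= leqNgt; apply/negP => /lt_s jin.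
by rewrite jin in js.
Qed.

(** A geodesic cannot pass through [b] between its ends: the vertices just before and after [b] are
    equal or adjacent, so bypassing [b] gives a shorter path. *)
Lemma convex_setC1_simplicial (G : sgraph) (b : G) :
  (forall x y, adj x b -> adj b y -> (x == y) || adj x y) ->
  convex (~: [set b]).
Proof.
move=> simp x y p; rewrite !inE => xb yb [px py pmin] z.
rewrite !inE; apply: contraL => /eqP->.
rewrite eq_sym (negPf xb) /=; apply/negP => /splitPr pE.
case: pE px py pmin => p1 [|w p3].
  by rewrite last_cat /= => _ /eqP; rewrite eq_sym (negPf yb).
rewrite cat_path last_cat /= => /and4P[pp1 ub bw pp3] py pmin.
case/orP: (simp _ _ ub bw) => [/eqP uw|uw].
  (* If the neighbours of [b] on the path coincide, both [b] and [w] are cut out; otherwise only [b]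
     is. *)
  have := pmin (p1 ++ p3); rewrite cat_path last_cat uw pp1 pp3 !size_cat /=.
  by move=> /(_ isT py); rewrite leq_add2l ltnNge leqnSn.
have := pmin (p1 ++ w :: p3).
rewrite cat_path last_cat /= uw pp1 pp3 !size_cat /=.
by move=> /(_ isT py); rewrite leq_add2l ltnn.
Qed.

(** The path x, v, y is a geodesic: length 0 is excluded by [x != y], length 1 by non-adjacency. *)
Lemma convex_common_neighbor (G : sgraph) (K : {set G}) (x y v : G) :
  convex K -> x \in K -> y \in K -> x != y -> ~~ adj x y ->
  adj x v -> adj v y -> v \in K.
Proof.
move=> cK xK yK xy nxy xv vy.
apply: (cK x y [:: v; y]) => //; last by rewrite !inE eqxx orbT.
split=> [||[|u [|? ?]]] //=; first by rewrite xv vy.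
  by move=> _ /eqP; rewrite (negPf xy).
by rewrite andbT => xu uy; rewrite -uy xu in nxy.
Qed.

Section GameValues.
Variables (G : sgraph) (A : {set G}).
Hypothesis spanningE : forall P : {set G}, spanning_compl P = (P \subset A).
Implicit Types P Q : {set G}.

Lemma adds_vertex_cardD P Q : adds_vertex P Q -> Q \subset A ->
  #|A :\: P| = #|A :\: Q|.+1.
Proof.
case/existsP=> v /andP[vP /eqP->]; rewrite subUset sub1set => /andP[vA _].
rewrite (cardsD1 v) !inE vA vP add1n; congr _.+1.
by apply: eq_card => x; rewrite !inE negb_or andbA.
Qed.

Lemma exists_adds_vertex P : P \subset A -> 0 < #|A :\: P| ->
  exists2 Q, adds_vertex P Q & Q \subset A.
Proof.
move=> PA /card_gt0P[v]; rewrite inE => /andP[vP vA].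
exists (v |: P); last by rewrite subUset sub1set vA.
by apply/existsP; exists v; rewrite vP eqxx.
Qed.

Lemma nim_pos_DNT (p : position (DNT G)) :
  nim_pos p = odd #|A :\: val p|.
Proof.
elim/(well_founded_ind (@opt_wf (DNT G))): p => p IHp; rewrite nim_posE.
have pA : val p \subset A by rewrite -spanningE (valP p).
have optE q : opt p q -> odd #|A :\: val p| = ~~ odd #|A :\: val q|.
  move=> pq; rewrite (@adds_vertex_cardD _ (val q)) //.
  by rewrite -spanningE (valP q).
(* Each move flips the parity, so no option has the value of [p]; as that value is at most 1, only 0
   may still have to be attained. *)
apply: mex_eq => [|[|i]]; last by case: odd.
  apply/imageP => -[q pq]; rewrite IHp // (optE q) //.
  by case: odd.
rewrite lt0b => /[dup] oddp /odd_gt0/(exists_adds_vertex pA)[Q pQ QA].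
rewrite -spanningE in QA.
have pq : @opt (DNT G) p (exist _ Q QA) by [].
apply/imageP; exists (exist _ Q QA) => //; rewrite IHp //.
by move: oddp; rewrite (optE _ pq) => /negPf->.
Qed.

Lemma ter_option (p : position (TER G)) Q :
  val p \subset A -> adds_vertex (val p) Q ->
  exists2 q : position (TER G), opt p q & val q = Q.
Proof.
move=> pA pQ.
have mQ : ter_move (val p) Q by rewrite /ter_move spanningE pA.
have cQ : connect (@ter_move G) set0 Q.
  exact: connect_trans (valP p) (connect1 mQ).
by exists (exist _ Q cQ).
Qed.

(** Taking [b] leads to a terminal position, so 0 is always among the option values inside [A]; this
    shifts the parity pattern up by one. *)
Lemma nim_pos_TER (b : G) (p : position (TER G)) : b \notin A ->
  nim_pos p = if val p \subset A then (odd #|A :\: val p|).+1 else 0.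
Proof.
move=> bA.
elim/(well_founded_ind (@opt_wf (TER G))): p => p IHp; rewrite nim_posE.
case: ifPn => [pA|npA]; last first.
  apply: mex_eq => //; apply/imageP => -[q /andP[]].
  by rewrite spanningE (negPf npA).
have optE q : opt p q -> val q \subset A ->
    odd #|A :\: val p| = ~~ odd #|A :\: val q|.
  by move=> /andP[_ pq] qA; rewrite (adds_vertex_cardD pq qA).
apply: mex_eq => [|[|[|i]]]; last by rewrite !ltnS; case: odd.
- apply/imageP => -[q pq]; rewrite IHp //; case: ifP => // qA.
  by rewrite (optE q) //; case: odd.
- have pb : adds_vertex (val p) (b |: val p).
    apply/existsP; exists b; rewrite eqxx andbT.
    by apply: contra bA; apply: (subsetP pA).
  have [q pq qE] := ter_option pA pb.
  move=> _; apply/imageP; exists q => //; rewrite IHp // qE.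
  by rewrite subUset sub1set (negPf bA).
(* The value 1 must be attained only when the claimed value is 2; then the number of vertices left
   in [A] is odd, hence positive. *)
rewrite ltnS lt0b => /[dup] oddp /odd_gt0/(exists_adds_vertex pA)[Q pQ QA].
have [q pq qE] := ter_option pA pQ; rewrite -qE in QA.
apply/imageP; exists q => //; rewrite IHp // QA.
by move: oddp; rewrite (optE _ pq QA) => /negPf->.
Qed.

Lemma nim_DNT : nim (DNT G) = pty #|A|.
Proof. by rewrite /nim nim_pos_DNT /= setD0 /pty modn2. Qed.

Lemma nim_TER (b : G) : b \notin A -> nim (TER G) = 1 + pty #|A|.
Proof.
by move=> bA; rewrite /nim (nim_pos_TER _ bA) /= sub0set setD0 /pty modn2.
Qed.

End GameValues.

Section SingletonParts.
Variables (k : nat) (m : k.-tuple nat).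
Let G := complete_multipartite m.

Definition singleton_parts : {set G} := [set v : G | tnth m (tag v) == 1].

Lemma singleton_parts_inj :
  {in singleton_parts &, injective (fun v : G => tag v)}.
Proof.
move=> [i a] [j c]; rewrite !inE /= => /eqP mi _ ij.
case: j / ij c => c; congr existT; apply: ord_inj.
have [ai ci] := (ltn_ord a, ltn_ord c).
(* Only the two bounds are rewritten, since the types of [a] and [c] also depend on [tnth m i]. *)
move: ai ci; rewrite [X in _ < X]mi [X in _ -> _ < X -> _]mi.
by do 2 case: nat_of_ord.
Qed.

Lemma card_singleton_parts :
  #|singleton_parts| = #|[set i : 'I_k | tnth m i == 1]|.
Proof.
rewrite -(card_in_imset singleton_parts_inj); apply: eq_card => i.
rewrite inE; apply/imsetP/eqP => [[v + ->]|mi]; first by rewrite inE => /eqP.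
have lt0 : 0 < tnth m i by rewrite mi.
exists (Tagged (fun i => 'I_(tnth m i)) (Ordinal lt0) : G) => //.
by rewrite inE /= mi.
Qed.

Variable i0 : 'I_k.
Hypotheses (m_gt0 : forall i, 0 < tnth m i).
Hypothesis big_part : forall i, (2 <= tnth m i) = (i == i0).

Lemma notin_singleton_parts (v : G) :
  (v \notin singleton_parts) = (tag v == i0).
Proof.
by rewrite inE -big_part; case: (tnth m (tag v)) (m_gt0 (tag v)) => [|[]].
Qed.

Lemma spanning_compl_singleton_parts (P : {set G}) :
  spanning_compl P = (P \subset singleton_parts).
Proof.
apply/eqP/idP => [hP|PA].
  apply/subsetP => b bP; apply/negPn/negP.
  rewrite notin_singleton_parts => /eqP bi.
  have cb : @convex G (~: [set b]).
    apply: convex_setC1_simplicial => x y xb _.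
    (* Neighbours of [b] avoid part [i0], so two of them in the same part lie in a singleton part
       and are equal. *)
    rewrite /= /cmp_adj; have [xy|_] := eqVneq (tag x) (tag y); last by rewrite orbT.
    rewrite orbF; apply/eqP/singleton_parts_inj => //; apply/negPn;
      rewrite notin_singleton_parts.
      by rewrite -bi.
    by rewrite -xy -bi.
  have : hull (~: P) \subset ~: [set b].
    by apply: hull_min => //; rewrite setCS sub1set.
  by rewrite hP => /subsetP/(_ b); rewrite !inE eqxx => /(_ isT).
have BK (v : G) : tag v == i0 -> v \in hull (~: P).
  rewrite -notin_singleton_parts => vA; apply: (subsetP (sub_hull _)).
  by rewrite inE; apply: contra vA; apply: (subsetP PA).
apply/eqP; rewrite -subTset; apply/subsetP => v _.
have [/BK//|vi] := boolP (tag v == i0).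
(* The vertices 0 and 1 of part [i0] are non-adjacent and have [v] as a common neighbour. *)
have gt1 : 1 < tnth m i0 by rewrite big_part.
pose x : G := Tagged (fun i => 'I_(tnth m i)) (Ordinal (ltnW gt1)).
pose y : G := Tagged (fun i => 'I_(tnth m i)) (Ordinal gt1).
apply: (@convex_common_neighbor G _ x y) => //.
- exact: hull_convex.
- exact: BK.
- exact: BK.
- by rewrite /x /y eq_Tagged.
- by rewrite /= /cmp_adj eqxx.
by rewrite /= /cmp_adj eq_sym.
Qed.

End SingletonParts.

(* [path leq 1 m] is 1 <= m_1 <= ... <= m_k, and [last 0 m] is m_k. *)
Theorem proposition5p8 (k : nat) (m : k.-tuple nat) :
  2 <= k -> path leq 1 m -> 2 <= last 0 m ->
  let G := complete_multipartite m in
  let sigma := #|[set i : 'I_k | tnth m i == 1]| in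
  let lambda := #|[set i : 'I_k | 2 <= tnth m i]| in
  lambda = 1 ->
  nim (DNT G) = pty sigma /\ nim (TER G) = 1 + pty sigma.
Proof.
move=> _ /(order_path_min leq_trans)/all_tnthP m_gt0 _ G sigma lambda.
move=> /eqP/cards1P[i0 /setP lamE].
have big_part i : (2 <= tnth m i) = (i == i0).
  by have := lamE i; rewrite !inE.
have spanE := spanning_compl_singleton_parts m_gt0 big_part.
(* A vertex of the big part, the move that ends TER at once. *)
pose b : G := Tagged (fun i => 'I_(tnth m i)) (Ordinal (m_gt0 i0)).
have bA : b \notin singleton_parts m.
  by rewrite (notin_singleton_parts m_gt0 big_part).
by rewrite (nim_DNT spanE) (nim_TER spanE bA) card_singleton_parts.
Qed.
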